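(* Consider the online bin covering problem with advice, and the advice strategy $\mathsf{DH}^{b+\lg n}_2$ (with $k=2$) described in the context, where the oracle supplies exact values of $m$ and $x_m$ (with $m$ chosen by the oracle, as described, to maximize the number of bins covered by the strategy). Then for every input sequence $\sigma$ of length $n$, $$|\mathsf{DH}^{b+\lg n}_2(\sigma)| \ge \frac{3}{5}\,|\mathsf{OPT}(\sigma)| - \frac{19}{15},$$ where $|\mathsf{OPT}(\sigma)|$ is the maximum number of bins that can be covered with the items of $\sigma$ and $|\mathsf{DH}^{b+\lg n}_2(\sigma)|$ is the number of bins covered by the strategy.
   Context: Bin covering: given a sequence $\sigma$ of items with rational sizes, each item size $v$ satisfying $0<v<1$, partition the items into bins; the load of a bin is the sum of its item sizes and a bin is covered if its load is at least $1$; the goal is to maximize the number of covered bins. Online: items arrive one by one and each must be irrevocably placed in a bin (existing or newly opened) before the next arrives. Advice model: an oracle knowing the entire input and the strategy writes a bit string (using a self-delimiting encoding) on an advice tape which the strategy may read. Dual Next Fit (DNF) on a stream of items: keep one active bin, put each item into it, and when it becomes covered close it and open a new empty active bin. Fix an integer $k\ge 2$. For an integer $2\le t\le k$, an item $v$ is a $t$-item if $1/t\le v<1/(t-1)$; an item $v<1/k$ is small. Let $x_1\ge x_2\ge\dots\ge x_n$ be the items of $\sigma$ sorted in non-increasing order. Strategy $\mathsf{DH}^{b+\lg n}_k$: it first reads from the advice an integer $m$ and the value $x_m$ (the $m$-th largest item of $\sigma$). It opens $m$ critical bins, each with an initial virtual load of $x_m$; it also opens one $t$-bin for each $t\in\{2,\dots,k\}$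 and one small bin. The virtual load of a critical bin equals the sum of its small items plus either $x_m$ (if it contains no item of size $\ge x_m$ yet) or the actual size of the item of size $\ge x_m$ it contains. When an item $v$ arrives: (1) if $x_m\le v$, place $v$ in the next critical bin that does not yet contain such a (2-)item and update its virtual load; (2) if $1/k\le v<x_m$ and $v$ is a $t$-item, place $v$ in the current $t$-bin using DNF (when it becomes covered, close it and open a new $t$-bin); (3) if $v<1/k$, place $v$ in the next critical bin whose virtual load is still below $1$ and update its virtual load; if all critical bins have virtual load at least $1$, place $v$ in the small bin using DNF (when it becomes covered, close it and open a new small bin). The oracle chooses $m$ by emulating the strategy for every integer $0\le m\le n_2$, where $n_2$ is the number of $2$-items in $\sigma$, and reports a value of $m$ for which the strategy covers as many bins as possible, together with the exact value $x_m$. *)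

(* Defs.v *)
From HB Require Import structures.
From mathcomp Require Import all_boot all_order all_algebra.
Set Implicit Arguments.
Unset Strict Implicit.
Unset Printing Implicit Defensive.
Import Order.TTheory GRing.Theory Num.Theory.
Local Open Scope ring_scope.

Definition valid_input (s : seq rat) : bool := all (fun v => (0 < v) && (v < 1)) s.

(* A partition of the n items into (at most n) bins is a labelling of items
   by bin indices in 'I_n.  A bin is covered if its load is at least 1. *)
Definition load (s : seq rat) (f : {ffun 'I_(size s) -> 'I_(size s)}) (b : 'I_(size s)) : rat :=
  \sum_(i : 'I_(size s) | f i == b) nth 0 s i.

Definition covered (s : seq rat) (f : {ffun 'I_(size s) -> 'I_(size s)}) : nat :=
  #|[set b : 'I_(size s) | 1 <= load f b]|.

Definition OPT (s : seq rat) : nat :=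
  \max_(f : {ffun 'I_(size s) -> 'I_(size s)}) covered f.

Definition n2 (s : seq rat) : nat := count (fun v => 2^-1 <= v) s.

(* x_m = m-th largest item (m >= 1); for m = 0 (no critical bins) we use the
   convention x_0 = 1, so that no item is ever routed to a critical bin. *)
Definition xm (s : seq rat) (m : nat) : rat :=
  if m is m'.+1 then nth 0 (sort (fun a b => b <= a) s) m' else 1.

(* a critical bin: (sum of its small items, its 2-item of size >= x_m if any) *)
Definition critbin := (rat * option rat)%type.

Definition vload (x : rat) (c : critbin) : rat :=
  c.1 + (if c.2 is Some b then b else x).

Definition aload (c : critbin) : rat :=
  c.1 + (if c.2 is Some b then b else 0).

Fixpoint put_big (v : rat) (cs : seq critbin) : option (seq critbin) :=
  match cs with
  | [::] => None
  | (sm, None) :: t => Some ((sm, Some v) :: t)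
  | c :: t => omap (cons c) (put_big v t)
  end.

Fixpoint put_small (x v : rat) (cs : seq critbin) : option (seq critbin) :=
  match cs with
  | [::] => None
  | c :: t => if vload x c < 1 then Some ((c.1 + v, c.2) :: t)
              else omap (cons c) (put_small x v t)
  end.

(* Dual Next Fit on a stream: (load of active bin, number of closed covered bins) *)
Definition dnf (v : rat) (st : rat * nat) : rat * nat :=
  if 1 <= st.1 + v then (0, st.2.+1) else (st.1 + v, st.2).

Record dh_state := DHState {
  crit : seq critbin;
  tbin : rat * nat;
  sbin : rat * nat
}.

Definition dh_step (x : rat) (st : dh_state) (v : rat) : dh_state :=
  if x <= v then
    match put_big v (crit st) with
    | Some cs => DHState cs (tbin st) (sbin st)
    (* convention when more than m items are >= x_m (ties): DNF 2-bin *)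
    | None => DHState (crit st) (dnf v (tbin st)) (sbin st)
    end
  else if 2^-1 <= v then DHState (crit st) (dnf v (tbin st)) (sbin st)
  else match put_small x v (crit st) with
       | Some cs => DHState cs (tbin st) (sbin st)
       | None => DHState (crit st) (tbin st) (dnf v (sbin st))
       end.

Definition dh_run (s : seq rat) (m : nat) : nat :=
  let x := xm s m in
  let fin := foldl (dh_step x) (DHState (nseq m (0, None)) (0, 0%N) (0, 0%N)) s in
  addn (addn (count (fun c : critbin => 1 <= aload c) (crit fin)) (tbin fin).2) (sbin fin).2.

Definition DH2 (s : seq rat) : nat := \max_(m < (n2 s).+1) dh_run s m.

(* Main.v *)
(* Let a, b, c be the numbers of bins covered by an optimal packing with exactly
   one, at least two, and no 2-items, and put d = 1 - x_m.  Truncate small items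
   at d: a critical bin receives truncated weight less than 2d, while every
   optimal bin without 2-items carries at least 2d, and every one whose only
   2-item is at most x_m (all but m - 1 of the a such bins) at least d.  Hence
   all m critical bins get covered as soon as 3m <= a + 2c + 1.  If 4c <= a, take
   m = (a + 2c + 1) / 3, which yields m + b + (a - m)/2 bins up to rounding.
   Otherwise take m = a / 2: the untruncated small volume left over by the
   critical bins is at least c - m/2, and the small bin turns two thirds of it
   into covered bins. *)
Require Import Defs.
From HB Require Import structures.
From mathcomp Require Import all_boot all_order all_algebra.
From mathcomp Require Import zify lra.
Import Order.TTheory GRing.Theory Num.Theory.
Local Open Scope ring_scope.

(** * Critical bins and the placement of one item *)

Definition has_big (c : critbin) : bool := isSome c.2.
Definition full (x : rat) (c : critbin) : bool := 1 <= vload x c.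
(** A small item, of size below 1/2, enters a bin only while its small load is below [1 - x]; hence
    the upper bound. *)
Definition good (x : rat) (c : critbin) : bool :=
  (0 <= c.1 <= 1 - x + 2^-1) && (if c.2 is Some b then x <= b else true).

(* Upper bound for the truncated small weight packed so far.  Small items are
   placed first-fit, so nothing lies beyond the first bin that is not full. *)
Fixpoint potential (x : rat) (cs : seq critbin) : rat :=
  if cs is c :: t then if full x c then 2 * (1 - x) + potential x t else c.1 else 0.

Lemma potential_ge0 x cs : 2^-1 <= x <= 1 ->
  all (good x) cs -> 0 <= potential x cs.
Proof.
move=> xb; elim: cs => //= c cs IH /andP[/andP[/andP[c0 _] _] /IH p0].
by case: ifP => _ //; lra.
Qed.

Lemma not_full_small x c : good x c -> ~~ full x c -> c.1 < 1 - x.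
Proof.
rewrite /good /full /vload -ltNge => /andP[_]; case: c => [l [b|]] /=; lra.
Qed.

(** Only full bins count [2 * (1 - x)], and the first bin that is not full holds less than
    [1 - x]. *)
Lemma potential_le x cs : 2^-1 <= x <= 1 ->
  all (good x) cs -> ~~ all (full x) cs ->
  potential x cs <= 2 * (1 - x) * (count (full x) cs)%:R + (1 - x).
Proof.
move=> xb; elim: cs => //= c cs IH /andP[gc gcs]; case: ifP => [fc|/negbT nf] /=.
  by move=> /(IH gcs) {}IH; rewrite natrD /=; lra.
move=> _; have := not_full_small x c gc nf; rewrite add0n => cd.
have : 0 <= (1 - x) * (count (full x) cs)%:R by rewrite mulr_ge0 //; lra.
lra.
Qed.

(** The item replaces a virtual load [x <= v], so no bin stops being full; a bin that becomes full
    trades a term below [1 - x] for at least [2 * (1 - x)]. *)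
Lemma put_bigP x v cs : 2^-1 <= x <= 1 ->
  x <= v -> all (good x) cs ->
  if put_big v cs is Some cs' then
    [/\ size cs' = size cs, count has_big cs' = (count has_big cs).+1,
        \sum_(c <- cs') c.1 = \sum_(c <- cs) c.1, all (good x) cs' &
        (all (full x) cs -> all (full x) cs') /\ potential x cs <= potential x cs']
  else all has_big cs.
Proof.
move=> xb xv; elim: cs => //= -[l [b|]] cs IH /= /andP[gc gcs].
  have := IH gcs; case: (put_big v cs) => //= cs' [sz ct sm gd [fl pt]].
  split=> //=; first by rewrite sz.
  - by rewrite ct.
  - by rewrite !big_cons sm.
  - by rewrite gc.
  split; first by case/andP=> -> /fl.
  by case: ifP => _; lra.
have p0 := potential_ge0 x cs xb gcs.
split=> //=; first by rewrite !big_cons.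
  by move: gc; rewrite /good /= gcs xv !andbT.
split.
  by case/andP=> + ->; rewrite /full /vload /= andbT; lra.
case: ifP => f1; case: ifP => f2 //.
  by move: f1 f2; rewrite /full /vload /=; lra.
by have := not_full_small x _ gc (negbT f1); rewrite /= in p0 *; lra.
Qed.

(** The receiving bin holds less than [1 - x], so even if it becomes full, its new term
    [2 * (1 - x)] accounts for the old load and the truncated item. *)
Lemma put_smallP x v cs : 2^-1 <= x <= 1 ->
  0 < v < 2^-1 -> all (good x) cs ->
  if put_small x v cs is Some cs' then
    [/\ size cs' = size cs, map has_big cs' = map has_big cs,
        \sum_(c <- cs') c.1 = \sum_(c <- cs) c.1 + v, all (good x) cs' &
        ~~ all (full x) cs /\ potential x cs + Num.min v (1 - x) <= potential x cs']
  else all (full x) cs.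
Proof.
move=> xb /andP[v0 v2]; elim: cs => //= c cs IH /andP[gc gcs].
rewrite {1}/vload -/(vload x c) ltNge -/(full x c).
case: ifP => [/negP/negP nf|/negbFE fc] /=.
  have p0 := potential_ge0 x cs xb gcs; have cd := not_full_small x c gc nf.
  have gc' : good x (c.1 + v, c.2).
    by move: gc; rewrite /good /= => /andP[/andP[? _] ->]; rewrite andbT; apply/andP; split; lra.
  split=> //=.
  - by rewrite !big_cons /=; lra.
  - by rewrite gc'.
  rewrite (negbTE nf) /=; split=> //.
  have : Num.min v (1 - x) <= v by rewrite ge_min lexx.
  have : Num.min v (1 - x) <= 1 - x by rewrite ge_min lexx orbT.
  by case: ifP => _; lra.
have := IH gcs; case: (put_small x v cs) => [cs'|] /=; last by rewrite fc.
case=> sz ct sm gd [fl pt]; split=> //=.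
- by rewrite sz.
- by rewrite ct.
- by rewrite !big_cons sm addrA.
- by rewrite gc.
by rewrite fc /=; split=> //; lra.
Qed.

(** * Invariant of a run *)

(** Items of size at least [x] spill into the 2-bin only once every critical bin has one, and small
    items reach the small bin only once every critical bin is full; hence the conditional forms of
    [inv_has_big] and [inv_weight]. *)
Record invariant (x : rat) (m : nat) (p : seq rat) (st : dh_state) : Prop := Invariant {
  inv_size : size (crit st) = m;
  inv_good : all (good x) (crit st);
  inv_has_big : ~~ all has_big (crit st) ->
    (count (fun v : rat => (x <= v)%R) p <= count has_big (crit st))%N;
  inv_tbin : (tbin st).1 = 0 \/ 2^-1 <= (tbin st).1;
  inv_n2 : (n2 p <= count has_big (crit st) + 2 * (tbin st).2 + ((tbin st).1 != 0%R))%N;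
  inv_sbin : 0 <= (sbin st).1 < 1;
  inv_small : \sum_(v <- p | v < 2^-1) v
     <= \sum_(c <- crit st) c.1 + (sbin st).1 + 3 / 2 * (sbin st).2%:R;
  inv_weight : all (full x) (crit st) \/
    \sum_(v <- p | v < 2^-1) Num.min v (1 - x) <= potential x (crit st) }.

Lemma invariant_init x m : 2^-1 <= x <= 1 ->
  invariant x m [::] (DHState (nseq m (0, None)) (0, 0%N) (0, 0%N)).
Proof.
move=> xb; have g0 : good x (0, None) by rewrite /good /=; apply/andP; split=> //; lra.
have g : all (good x) (nseq m (0, None)) by rewrite all_nseq g0 orbT.
split=> //=; first by rewrite size_nseq.
- by left.
- by rewrite big_nil big_nseq /= iter_addr_0 mul0rn; lra.
by right; rewrite big_nil potential_ge0.
Qed.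

(** Two 2-items always cover a bin and one never does, so every second 2-item closes the active
    bin. *)
Lemma dnf_big (v : rat) (t : rat * nat) : 2^-1 <= v < 1 -> t.1 = 0 \/ 2^-1 <= t.1 ->
  ((dnf v t).1 = 0 \/ 2^-1 <= (dnf v t).1) /\
  (2 * (dnf v t).2 + ((dnf v t).1 != 0%R) = (2 * t.2 + (t.1 != 0%R)).+1)%N.
Proof.
rewrite /dnf => vb [t0|t2].
  rewrite t0 add0r eqxx; case: ifP => [?|_] /=; first by exfalso; lra.
  have -> : v != 0 by apply/eqP; lra.
  by split; [right; lra | lia].
have -> : t.1 != 0 by apply/eqP; lra.
case: ifP => [_|?] /=; last by exfalso; lra.
by split; [left | lia].
Qed.

Lemma n2_rcons p v : n2 (rcons p v) = (n2 p + (2^-1 <= v)%R)%N.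
Proof. by rewrite /n2 -cats1 count_cat /= addn0. Qed.

Lemma small_sum_rcons (g : rat -> rat) p v :
  \sum_(w <- rcons p v | w < 2^-1) g w =
  \sum_(w <- p | w < 2^-1) g w + (if v < 2^-1 then g v else 0).
Proof. by rewrite -cats1 big_cat big_cons big_nil; case: ifP => _; rewrite /= ?addr0. Qed.

Lemma invariant_step x m p st v : 2^-1 <= x <= 1 ->
  0 < v < 1 -> invariant x m p st ->
  invariant x m (rcons p v) (dh_step x st v).
Proof.
move=> xb vb [sz gd hb tb nn sb sm wt].
rewrite /dh_step; case: ifP => xv.
  have v2 : 2^-1 <= v by lra.
  have nv : (v < 2^-1) = false by lra.
  have := put_bigP x v _ xb xv gd; case: put_big => [cs [sz' ct' sm' gd' [fl pt]]|al].
    split=> //=; rewrite ?sz' ?sm' //.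
    - move=> nall; rewrite -cats1 count_cat /= xv ct' addn0 addn1 ltnS hb //.
      apply: contra nall; rewrite !all_count ct' sz' => /eqP al.
      by have := count_size has_big cs; rewrite ct' sz' al ltnn.
    - by rewrite n2_rcons v2 ct' addn1 !addSn ltnS.
    - by rewrite small_sum_rcons nv addr0.
    case: wt => [/fl|wt]; [by left | right].
    by rewrite small_sum_rcons nv addr0; lra.
  have [|tb' nn'] := dnf_big v (tbin st) _ tb; first lra.
  split=> //=.
  - by rewrite al.
  - by rewrite n2_rcons v2 addn1 -addnA nn' addnS ltnS addnA.
  - by rewrite small_sum_rcons nv addr0.
  by rewrite small_sum_rcons nv addr0.
have cx : count (fun w : rat => (x <= w)%R) (rcons p v) = count (fun w : rat => (x <= w)%R) p.
  by rewrite -cats1 count_cat /= xv !addn0.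
case: ifP => v2.
  have nv : (v < 2^-1) = false by lra.
  have [|tb' nn'] := dnf_big v (tbin st) _ tb; first lra.
  split=> //=; rewrite ?cx //.
  - by rewrite n2_rcons v2 addn1 -addnA nn' addnS ltnS addnA.
  - by rewrite small_sum_rcons nv addr0.
  by rewrite small_sum_rcons nv addr0.
have nv : v < 2^-1 by lra.
have n2v : n2 (rcons p v) = n2 p by rewrite n2_rcons v2 addn0.
have vb' : 0 < v < 2^-1 by lra.
have := put_smallP x v _ xb vb' gd; case: put_small => [cs [sz' ct' sm' gd' [fl pt]]|al].
  have cb : count has_big cs = count has_big (crit st).
    by rewrite -(count_map has_big id) ct' count_map.
  have ab : all has_big cs = all has_big (crit st).
    by rewrite !all_count cb sz'.
  split=> //=; rewrite ?sz' ?cx ?ab ?cb ?n2v //.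
    by rewrite small_sum_rcons nv sm' /=; lra.
  case: wt => [al|wt]; first by rewrite al in fl.
  by right; rewrite small_sum_rcons nv /=; lra.
split=> //=; rewrite ?cx ?n2v //.
- by rewrite /dnf; case: ifP => /= ?; lra.
- rewrite small_sum_rcons nv /= /dnf; case: ifP => /= _.
    (* The closed bin has load below 1 + 1/2, which its share 3/2 covers. *)
    by rewrite -[(sbin st).2.+1]addn1 natrD; lra.
  by lra.
by left.
Qed.


(** * Items in sorted order *)

Lemma count_le_drop (P : pred rat) t m :
  (forall i, (m <= i < size t)%N -> ~~ P (nth 0 t i)) -> (count P t <= m)%N.
Proof.
move=> h; rewrite -[t in count _ t](cat_take_drop m t) count_cat.
have -> : count P (drop m t) = 0%N.
  apply/eqP; rewrite -leqn0 leqNgt -has_count; apply/negP => /(has_nthP 0)[i].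
  rewrite size_drop nth_drop => im; apply/negP/h.
  by rewrite leq_addr -ltn_subRL.
rewrite addn0 (leq_trans (count_size _ _)) // size_take.
by case: ifP => // /negbT; rewrite -leqNgt.
Qed.

Lemma nth_sort_ge (s : seq rat) i j : (i <= j < size s)%N ->
  nth 0 (sort (fun a b => b <= a) s) j <= nth 0 (sort (fun a b => b <= a) s) i.
Proof.
case/andP=> ij js.
have tr : transitive (fun a b : rat => b <= a) by move=> a b c ab bc; exact: le_trans bc ab.
have st : sorted (fun a b : rat => b <= a) (sort (fun a b => b <= a) s).
  by apply: sort_sorted => a b; exact: le_total.
by apply: (sorted_leq_nth tr _ 0 st) => //; rewrite inE size_sort // (leq_ltn_trans ij).
Qed.

Lemma count_gt_xm s m : (count (fun v => (xm s m.+1 < v)%R) s <= m)%N.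
Proof.
rewrite -(permP (permEl (perm_sort (fun a b => b <= a) s))).
apply: count_le_drop => i; rewrite size_sort => ib.
by rewrite -leNgt nth_sort_ge.
Qed.

Lemma count_ge_xm s m : (m < size s)%N -> (m < count (fun v => (xm s m.+1 <= v)%R) s)%N.
Proof.
move=> ms; rewrite -(permP (permEl (perm_sort (fun a b => b <= a) s))).
set t := sort _ _.
rewrite -(cat_take_drop m.+1 t) count_cat.
apply: leq_trans (leq_addr _ _).
have szt : size (take m.+1 t) = m.+1 by rewrite size_takel // size_sort.
suff : all (fun v => xm s m.+1 <= v) (take m.+1 t) by rewrite all_count szt => /eqP ->.
apply/(all_nthP 0) => i; rewrite szt ltnS => im.
by rewrite nth_take // nth_sort_ge // im.
Qed.

(** For positive [m] the threshold is itself a 2-item; the conventional value 1 at [m = 0] fits the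
    same bounds. *)
Lemma xm_bounds s m : valid_input s -> (m <= n2 s)%N -> 2^-1 <= xm s m <= 1.
Proof.
case: m => [|m] /allP vs mn; first by rewrite /=; lra.
have ms : (m < size s)%N by rewrite (leq_trans mn) // count_size.
have xs : xm s m.+1 \in s by rewrite /= -(mem_sort (fun a b => b <= a)) mem_nth ?size_sort.
have /andP[_ /ltW ->] := vs _ xs; rewrite andbT leNgt; apply/negP => lt.
have: (n2 s <= m)%N; last by rewrite leqNgt mn.
rewrite /n2 -(permP (permEl (perm_sort (fun a b => b <= a) s))).
apply: count_le_drop => i; rewrite size_sort => ib.
by rewrite -ltNge (le_lt_trans _ lt) // nth_sort_ge.
Qed.

Lemma xm_lt1 s m : valid_input s -> (m < n2 s)%N -> xm s m.+1 < 1.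
Proof.
move=> /allP vs mn; have ms : (m < size s)%N by rewrite (leq_trans mn) // count_size.
have xs : xm s m.+1 \in s by rewrite /= -(mem_sort (fun a b => b <= a)) mem_nth ?size_sort.
by have /andP[] := vs _ xs.
Qed.

(** * Guarantee for a fixed [m] *)

Lemma invariant_run x m s : 2^-1 <= x <= 1 -> valid_input s ->
  invariant x m s (foldl (dh_step x) (DHState (nseq m (0, None)) (0, 0%N) (0, 0%N)) s).
Proof.
move=> xb; elim/last_ind: s => [|s v IH]; first by move=> _; exact: invariant_init.
rewrite /valid_input all_rcons foldl_rcons => /andP[vb /IH].
exact: invariant_step.
Qed.

(** The required weight exceeds what the potential can reach while some critical bin is not full.
    The case [m = 0] stands apart: there [d = 0] and the strict bound fails. The terms [+ 1] pay for
    the active 2-bin and the active small bin. *)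
Lemma dh_run_ge s m : valid_input s -> (m <= n2 s)%N ->
  let d := 1 - xm s m in
  (m = 0%N \/ 2 * d * m%:R - d < \sum_(v <- s | v < 2^-1) Num.min v d) ->
  exists b q : nat, [/\ dh_run s m = (m + b + q)%N, (n2 s <= m + 2 * b + 1)%N &
    \sum_(v <- s | v < 2^-1) v <= m%:R * (d + 2^-1) + 1 + 3 / 2 * q%:R].
Proof.
move=> vs mn d W; have xb := xm_bounds s m vs mn.
have := invariant_run (xm s m) m s xb vs; rewrite /dh_run.
set st := foldl _ _ _ => -[sz gd hb tb nn sb sm wt].
(* At least [m] items reach the threshold, so a critical bin without one would contradict
   [inv_has_big]. *)
have big : all has_big (crit st).
  apply/negPn/negP => nb; have := hb nb.
  have : (m <= count (fun v => (xm s m <= v)%R) s)%N.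
    by case: (m) mn => // m' mn; rewrite count_ge_xm // (leq_trans mn) // count_size.
  have : (count has_big (crit st) < m)%N.
    by rewrite -sz ltn_neqAle count_size andbT -all_count.
  by move=> h1 h2 /(leq_trans h2); rewrite leqNgt h1.
have fl : all (full (xm s m)) (crit st).
  case: W => [m0|W].
    by move: sz; rewrite m0 => /size0nil ->.
  case: wt => [//|wt]; apply/negPn/negP => nf.
  have := potential_le _ _ xb gd nf.
  have : (count (full (xm s m)) (crit st) < m)%N.
    by move: nf; rewrite all_count sz ltn_neqAle => ->; rewrite -[leqRHS]sz count_size.
  rewrite -(ler_nat rat) -addn1 natrD => cm pl.
  have : 0 <= d * (m%:R - (count (full (xm s m)) (crit st))%:R - 1).
    by apply: mulr_ge0; [rewrite /d; lra | lra].
  by rewrite /d in W *; lra.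
(* Once the big item is present, virtual and actual load agree. *)
have cov : count (fun c : critbin => 1 <= aload c) (crit st) = m.
  rewrite -sz; apply/eqP; rewrite -all_count; apply/allP => c cs.
  have := allP fl c cs; have := allP big c cs.
  by rewrite /has_big /full /vload /aload; case: (c.2).
exists (tbin st).2, (sbin st).2; rewrite cov; split=> //.
  move: big nn; rewrite all_count sz => /eqP -> nn.
  by apply: leq_trans nn _; rewrite leq_add2l leq_b1.
have : \sum_(c <- crit st) c.1 <= m%:R * (d + 2^-1).
  rewrite -sz mulr_natl -iter_addr_0 -count_predT -big_const_seq big_seq [leRHS]big_seq.
  by apply: ler_sum => c cs; have /andP[/andP[]] := allP gd c cs.
by lra.
Qed.

(** * Small items in an arbitrary packing *)

(** Either one term reaches [d] by itself, or no term is truncated. *)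
Lemma sum_min_ge (I : finType) (P : pred I) (v : I -> rat) d :
  0 <= d -> (forall i, P i -> 0 <= v i) -> d <= \sum_(i | P i) v i ->
  d <= \sum_(i | P i) Num.min (v i) d.
Proof.
move=> d0 v0 dv.
have [/existsP[i /andP[Pi di]]|/existsPn nd] := boolP [exists i, P i && (d <= v i)].
  rewrite (bigD1 i) //= (min_r di) lerDl sumr_ge0 // => j /andP[Pj _].
  by rewrite le_min v0.
rewrite (eq_bigr v) // => i Pi; rewrite min_l //.
by have := nd i; rewrite Pi /= -ltNge => /ltW.
Qed.

(** Termwise, [2 * d * v] is at most [v] since [d <= 1/2], and at most [d] since [v <= 1/2]. *)
Lemma sum_min_ge_scaled (I : finType) (P : pred I) (v : I -> rat) d :
  0 <= d <= 2^-1 -> (forall i, P i -> 0 <= v i <= 2^-1) ->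
  2 * d * \sum_(i | P i) v i <= \sum_(i | P i) Num.min (v i) d.
Proof.
move=> db vb; rewrite mulr_sumr; apply: ler_sum => i /vb vi.
by rewrite le_min; apply/andP; split; nra.
Qed.

Section Bins.
Variables (s : seq rat) (f : {ffun 'I_(size s) -> 'I_(size s)}).
Definition bin_n2 (j : 'I_(size s)) : nat :=
  \sum_(i : 'I_(size s) | f i == j) (2^-1 <= nth 0 s i)%R.

(** The choices [pred1 1], [leq 2] and [pred1 0] give a, b and c. *)
Definition bins_with (p : pred nat) : nat :=
  \sum_(j : 'I_(size s)) ((1 <= load f j)%R && p (bin_n2 j)).

Lemma count_bins (p : pred rat) :
  (\sum_(j : 'I_(size s)) \sum_(i : 'I_(size s) | f i == j) p (nth 0%R s i) = count p s)%N.
Proof.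
rewrite -sum1_count (big_nth 0) big_mkord [RHS](partition_big f xpredT) //=.
by apply: eq_bigr => j _; rewrite [RHS]big_mkcondl; apply: eq_bigr => i _; case: (p _).
Qed.

Lemma covered_bins :
  covered f = (bins_with (pred1 1) + bins_with (leq 2) + bins_with (pred1 0))%N.
Proof.
rewrite /covered -sum1_card /bins_with -!big_split big_mkcond /=.
apply: eq_bigr => j _; rewrite inE; case: (1 <= _) => //=.
by case: (bin_n2 j) => [|[|]].
Qed.

Lemma bins_n2 : (bins_with (pred1 1) + 2 * bins_with (leq 2) <= n2 s)%N.
Proof.
rewrite /n2 -count_bins /bins_with mul2n -addnn -!big_split /=; apply: leq_sum => j _.
by rewrite -/(bin_n2 j); case: (1 <= _) => //=; case: (bin_n2 j) => [|[|]].
Qed.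

(* [g] is either the identity or truncation at [d]; a bin with a single 2-item
   needs small weight [d] unless that item exceeds [1 - d]. *)
Lemma small_weight_ge (g : rat -> rat) (d e : rat) :
  valid_input s -> 0 <= d -> 0 <= e ->
  (forall w, 0 < w < 2^-1 -> 0 <= g w) ->
  (forall P : pred 'I_(size s), (forall i, P i -> 0 < nth 0 s i < 2^-1) ->
     (d <= \sum_(i | P i) nth 0 s i -> d <= \sum_(i | P i) g (nth 0 s i)) /\
     (1 <= \sum_(i | P i) nth 0 s i -> e <= \sum_(i | P i) g (nth 0 s i))) ->
  e * (bins_with (pred1 0))%:R
    + d * ((bins_with (pred1 1))%:R - (count (fun w => (1 - d < w)%R) s)%:R)
  <= \sum_(w <- s | w < 2^-1) g w.
Proof.
move=> vs d0 e0 g0 gP.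
have vb i : (i < size s)%N -> 0 < nth 0 s i < 1 by move=> si; apply: (allP vs); rewrite mem_nth.
(* Items above [1 - d] are counted bin by bin too, so the inequality can be proved for each bin
   separately. *)
rewrite (big_nth 0) big_mkord (partition_big f xpredT) //= -count_bins /bins_with.
rewrite !natr_sum -sumrB !mulr_sumr -big_split /=; apply: ler_sum => j _.
set P := fun i : 'I_(size s) => (nth 0 s i < 2^-1) && (f i == j).
have Pb i : P i -> 0 < nth 0 s i < 2^-1.
  by case/andP=> -> _; have /andP[-> _] := vb i (ltn_ord i); rewrite andbT.
have [gd ge] := gP P Pb.
have G0 : 0 <= \sum_(i | P i) g (nth 0 s i) by apply: sumr_ge0 => i /Pb /g0.
have big_le y : (forall i, f i == j -> nth 0 s i <= y) ->
    load f j <= \sum_(i | P i) nth 0 s i + (bin_n2 j)%:R * y.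
  move=> vy; rewrite /load (bigID (fun i : 'I_(size s) => nth 0 s i < 2^-1)) /=.
  apply: lerD.
    by rewrite (eq_bigl P) // => i; rewrite andbC.
  rewrite /bin_n2 natr_sum mulr_suml big_mkcondr /=; apply: ler_sum => i /vy vi.
  by rewrite -leNgt; case: ifP => _ /=; rewrite ?mul0r ?mul1r.
set K := (\sum_(i | _) _)%N.
have K0 : 0 <= d * K%:R by rewrite mulr_ge0.
have [cov|_] /= := boolP (1 <= load f j); last by lra.
have [k0|k0] := eqVneq (bin_n2 j) 0%N.
  rewrite k0 /=; have := big_le 1 (fun i _ => ltW (proj2 (andP (vb i (ltn_ord i))))).
  rewrite k0 mul0r addr0 => /(le_trans cov) /ge; lra.
have [k1|k1] /= := eqVneq (bin_n2 j) 1%N; last by lra.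
(* An item above [1 - d] cancels the [d] claimed for this bin; without one, the only 2-item is at
   most [1 - d] and small items supply the rest. *)
have [Kz|Kz] := posnP K.
  have vx i : f i == j -> nth 0 s i <= 1 - d.
    move=> fi; rewrite leNgt; apply/negP => lt.
    by move: Kz; rewrite /K (bigD1 i) //= lt.
  have := big_le _ vx; rewrite k1 mul1r => lb.
  have /gd : d <= \sum_(i | P i) nth 0 s i by lra.
  by rewrite Kz /=; lra.
have : d * 1 <= d * K%:R by rewrite ler_wpM2l // ler1n.
by lra.
Qed.

End Bins.

(** Both bounds come from [small_weight_ge] for an optimal packing: the identity with [e = 1], and
    truncation with [e = 2 * d]. *)
Lemma OPT_decomposition s : valid_input s -> exists a b c : nat,
  [/\ OPT s = (a + b + c)%N, (a + 2 * b <= n2 s)%N &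
   forall x, 2^-1 <= x <= 1 ->
   let d := 1 - x in let k := count (fun w => (x < w)%R) s in
   c%:R + d * (a%:R - k%:R) <= \sum_(w <- s | w < 2^-1) w /\
   2 * d * c%:R + d * (a%:R - k%:R) <= \sum_(w <- s | w < 2^-1) Num.min w d].
Proof.
move=> vs; have [f ->] : {f | OPT s = @covered s f}.
  by apply: bigop.eq_bigmax; apply/card_gt0P; exists [ffun i => i].
exists (bins_with s f (pred1 1%N)), (bins_with s f (leq 2)), (bins_with s f (pred1 0%N)).
split; [exact: covered_bins | exact: bins_n2 | move=> x xb d k].
have d0 : 0 <= d by rewrite /d; lra.
have xd : 1 - d = x by rewrite /d; lra.
split.
  have := @small_weight_ge s f id d 1 vs d0 ler01; rewrite xd mul1r; apply=> //.
  by move=> w /andP[/ltW].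
have dd0 : 0 <= 2 * d by lra.
have := @small_weight_ge s f (fun w => Num.min w d) d (2 * d) vs d0 dd0; rewrite xd; apply.
  by move=> w /andP[/ltW w0 _]; rewrite le_min w0.
move=> P Pb; split.
  by apply: sum_min_ge => // i /Pb /andP[/ltW].
move=> P1; apply: (le_trans _ (@sum_min_ge_scaled _ P _ d _ _)).
- by rewrite ler_peMr.
- by rewrite /d; lra.
by move=> i /Pb; lra.
Qed.

(** * The choice of [m] *)

Theorem theorem1 (s : seq rat) :
  valid_input s ->
  (3 / 5) * (OPT s)%:R - 19 / 15 <= (DH2 s)%:R :> rat.
Proof.
move=> vs; have [a [b [c [-> abn bnd]]]] := OPT_decomposition s vs.
have b0 : 0 <= b%:R :> rat by [].
have DH_ge m : (m <= n2 s)%N -> (dh_run s m)%:R <= (DH2 s)%:R :> rat.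
  move=> mn; rewrite ler_nat.
  exact: (leq_bigmax (F := fun i : 'I__ => dh_run s i) (Ordinal (mn : m < (n2 s).+1)%N)).
have weight m : (m <= n2 s)%N -> (3 * m <= a + 2 * c + 1)%N ->
    m = 0%N \/ 2 * (1 - xm s m) * m%:R - (1 - xm s m)
                 < \sum_(v <- s | v < 2^-1) Num.min v (1 - xm s m).
  case: m => [|m] mn ma; [by left | right].
  have [_ W] := bnd _ (xm_bounds s m.+1 vs mn).
  apply: lt_le_trans W; move: ma (count_gt_xm s m) (xm_lt1 s m vs mn).
  set k := count _ s; set x := xm s _; rewrite -[m.+1]addn1.
  rewrite -!(ler_nat rat) !(natrM, natrD) => ma km x1.
  (* The index is now [m + 1], so [k <= m] and [3 * m + 2 <= a + 2 * c]: the second factor is at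
     least 1. *)
  have : 0 < (1 - x) * (2 * c%:R + a%:R - k%:R - 2 * m%:R - 1) by apply: mulr_gt0; lra.
  by lra.
have [ca|ca] := leqP (4 * c) a.
  set m := ((a + 2 * c + 1) %/ 3)%N.
  have mn : (m <= n2 s)%N by rewrite /m; lia.
  have m3 : (3 * m <= a + 2 * c + 1)%N by rewrite /m; lia.
  have m3' : (a + 2 * c <= 3 * m + 1)%N by rewrite /m; lia.
  have [b' [q [e n _]]] := dh_run_ge s m vs mn (weight m mn m3).
  have := DH_ge m mn; rewrite e; apply: le_trans.
  have {}n : (a + 2 * b <= m + 2 * b' + 1)%N by exact: leq_trans n.
  have q0 : 0 <= q%:R :> rat by [].
  (* Here [m + b'] is at least 2a/3 + b + c/3 - 2/3, and [4 * c <= a] suffices. *)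
  move: ca m3' n; rewrite -!(ler_nat rat) !(natrM, natrD); lra.
set m := a./2.
have mn : (m <= n2 s)%N by rewrite /m; lia.
have m3 : (3 * m <= a + 2 * c + 1)%N by rewrite /m; lia.
have m2 : (2 * m <= a)%N by rewrite /m; lia.
have m2' : (a <= 2 * m + 1)%N by rewrite /m; lia.
have [b' [q [e n Sle]]] := dh_run_ge s m vs mn (weight m mn m3).
have := DH_ge m mn; rewrite e; apply: le_trans.
have {}n : (a + 2 * b <= m + 2 * b' + 1)%N by exact: leq_trans n.
have xb := xm_bounds s m vs mn.
have [{}bnd _] := bnd _ xb.
have Sc : c%:R + (1 - xm s m) * (a%:R - m%:R) <= \sum_(w <- s | w < 2^-1) w.
  apply: le_trans bnd; rewrite lerD2l.
  case: (m) xb => [|m'] xb; first by rewrite /= subrr !mul0r.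
  by rewrite ler_wpM2l ?lerB ?ler_nat ?(leq_trans (count_gt_xm s m')) //; lra.
(* As [a - m >= m], the term with [a - m] in [Sc] pays for the excess [m * (1 - xm s m)] in the
   critical bins. *)
have : 0 <= (1 - xm s m) * (a%:R - 2 * m%:R).
  by apply: mulr_ge0; [lra | rewrite subr_ge0 -natrM ler_nat].
(* The total is at least 7a/12 + b + 2c/3 - 5/4, where 5/4 sums 1/2 for an unpaired 2-item, 2/3 for
   the active small bin and 1/12 for odd [a]; [a <= 4 * c] concludes. *)
move: m2 m2' n (ltnW ca) Sle Sc; rewrite -!(ler_nat rat) !(natrM, natrD); lra.
Qed.
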